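(* Let $p>3$ be a prime, $q$ a power of $p$, $l\ge 0$ an integer, and $k=4$. Then $D_{p^l+2,k}(1,x)$ is a permutation polynomial of $\mathbb{F}_q$ if and only if the binomial $x^{\frac{p^l-1}{2}}-\frac12 x$ is a permutation polynomial of $\mathbb{F}_q$.
   Context: For an integer $k$ with $0\le k\le p-1$ and an integer $n\ge1$, $D_{n,k}(1,x)=\sum_{i=0}^{\lfloor n/2\rfloor}\frac{n-ki}{n-i}\binom{n-i}{i}(-x)^i\in\mathbb{F}_q[x]$ (the coefficients are integers, reduced mod $p$). A permutation polynomial of $\mathbb{F}_q$ is a polynomial inducing a bijection of $\mathbb{F}_q$. *)

(* Defs.v *)
From mathcomp Require Import all_boot all_order all_algebra all_field.

Set Implicit Arguments.
Unset Strict Implicit.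
Unset Printing Implicit Defensive.

Import Order.TTheory GRing.Theory Num.Theory.
Local Open Scope ring_scope.

(* The coefficient (n - k i) / (n - i) * binomial(n - i, i).  The numerator is
   signed (n - k i may be negative), and the integer division is exact, as
   shown by [rdickson_coef_exact]. *)
Definition rdickson_coef (n k i : nat) : int :=
  ((n%:Z - k%:Z * i%:Z) * 'C(n - i, i)%:Z %/ (n - i)%N%:Z)%Z.

(* D_{n,k}(1, x), the reversed Dickson polynomial of the (k+1)-th kind with its
   first parameter equal to 1; meaningful for n >= 1. *)
Definition rdickson1 (R : nzRingType) (n k : nat) : {poly R} :=
  \sum_(0 <= i < (n %/ 2).+1) (rdickson_coef n k i)%:~R *: (- 'X) ^+ i.

Definition permutation_poly (F : finFieldType) (f : {poly F}) : Prop :=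
  bijective (fun x : F => f.[x]).

Lemma rdickson_coef_dvd (n k i : nat) : (i <= n)%N ->
  ((n - i)%N%:Z %| (n%:Z - k%:Z * i%:Z) * 'C(n - i, i)%:Z)%Z.
Proof.
move=> le_in.
have -> : n%:Z - k%:Z * i%:Z = (n - i)%N%:Z + (1 - k%:Z) * i%:Z.
  by rewrite -subzn // mulrBl mul1r addrA subrK.
rewrite mulrDl -mulrA; apply: rpredD; first exact: dvdz_mulr.
apply: dvdz_mull; case: i {le_in} => [|i]; first by rewrite mul0r dvdz0.
case: (n - i.+1)%N => [|m]; first by rewrite bin0n mulr0 dvdz0.
by rewrite -PoszM -mul_bin_diag PoszM dvdz_mulr.
Qed.

Lemma rdickson_coef_exact (n k i : nat) : (0 < n)%N -> (i <= n %/ 2)%N ->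
  (rdickson_coef n k i)%:~R =
    (n%:R - k%:R * i%:R) / (n - i)%N%:R * 'C(n - i, i)%:R :> rat.
Proof.
move=> n_gt0 le_i.
have lt_in : (i < n)%N by apply: leq_ltn_trans le_i _; rewrite ltn_Pdiv.
have nz : (n - i)%N%:R != 0 :> rat by rewrite pnatr_eq0 -lt0n subn_gt0.
apply: (mulIf nz); rewrite mulrAC divfK //.
have /divzK E := rdickson_coef_dvd k (ltnW lt_in).
have := congr1 (fun z : int => z%:~R : rat) E.
by rewrite !rmorphM rmorphB rmorphM.
Qed.

(* Main.v *)
Require Import Defs.
From mathcomp Require Import all_boot all_order all_algebra all_field.
From mathcomp Require Import ring zify.

(** Write E_n(x) for the sum of binom(n-i,i) (-x)^i.  Since n - ki equals
    (n - i) + (1 - k) i, one has D_{n+2,k} = E_{n+2} + (k-1) x E_n.  With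
    x = y(1-y) and u = 2y - 1, so that u^2 = 1 - 4x, Binet's formula reads
    u E_n = y^(n+1) - (1-y)^(n+1); for Q = p^l the Frobenius map y -> y^Q
    is additive, which yields E_{Q-1} = (1-4x)^((Q-1)/2) and
    2 E_Q = 1 + (1-4x)^((Q-1)/2).  Hence
    D_{Q+2,4} = 3/4 + (1/2) g(1-4x), where g is the binomial of the theorem:
    the two polynomials are affinely equivalent. *)

Set Implicit Arguments.
Unset Strict Implicit.
Unset Printing Implicit Defensive.

Import Order.TTheory GRing.Theory Num.Theory.
Local Open Scope ring_scope.

(** This is $E_n$, the reversed Dickson polynomial of the second kind, kept as a function on any
    ring so that it can be taken at ['X] and at y(1-y) alike. *)
Definition fibp (R : nzRingType) (n : nat) (x : R) : R :=
  \sum_(i < (n %/ 2).+1) 'C(n - i, i)%:R * (- x) ^+ i.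

(** Past n/2 the binomials vanish, also where [n - i] truncates to 0. Sums for different n can thus
    share a range. *)
Lemma fibp_widen (R : nzRingType) (n m : nat) (x : R) : (n %/ 2 < m)%N ->
  fibp n x = \sum_(i < m) 'C(n - i, i)%:R * (- x) ^+ i.
Proof.
move=> lt_m; rewrite /fibp.
rewrite (big_ord_widen m (fun i => 'C(n - i, i)%:R * (- x) ^+ i)) //.
rewrite big_mkcond; apply: eq_bigr => i _.
by case: ifP => // /negbT lt_i; rewrite bin_small ?mul0r //; lia.
Qed.

Lemma fibp_morph (R S : nzRingType) (f : {rmorphism R -> S}) (n : nat) (x : R) :
  f (fibp n x) = fibp n (f x).
Proof.
rewrite rmorph_sum; apply: eq_bigr => i _.
by rewrite rmorphM rmorphXn rmorphN rmorph_nat.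
Qed.

Lemma fibp0 (R : nzRingType) (x : R) : fibp 0 x = 1.
Proof. by rewrite /fibp big_ord1 expr0 mulr1. Qed.

Lemma fibp1 (R : nzRingType) (x : R) : fibp 1 x = 1.
Proof. by rewrite /fibp big_ord1 expr0 mulr1. Qed.

(** Pascal's rule, term by term. *)
Lemma fibpSS (R : comNzRingType) (n : nat) (x : R) :
  fibp n.+2 x = fibp n.+1 x - x * fibp n x.
Proof.
rewrite (@fibp_widen _ n.+2 n.+2); last by lia.
rewrite (@fibp_widen _ n.+1 n.+2); last by lia.
rewrite (@fibp_widen _ n n.+1); last by lia.
rewrite big_ord_recl [in RHS]big_ord_recl /= !bin0 -addrA; congr (_ + _).
rewrite -mulNr mulr_sumr -big_split /=; apply: eq_bigr => i _.
rewrite /bump /= add1n !subSS subSn; last by rewrite -ltnS.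
by rewrite binS natrD exprS; ring.
Qed.

(** The recurrence [fibpSS] at x = y(1-y) has characteristic polynomial t^2 - t + x, with roots y
    and 1-y, so both sides obey it. *)
Lemma fibp_binet (R : comNzRingType) (n : nat) (y : R) :
  (2 * y - 1) * fibp n (y * (1 - y)) = y ^+ n.+1 - (1 - y) ^+ n.+1.
Proof.
elim/ltn_ind: n => -[_|[_|n IH]]; first by rewrite fibp0; ring.
  by rewrite fibp1; ring.
rewrite fibpSS mulrBr mulrCA !IH //.
by rewrite !exprS; ring.
Qed.

(** Justifies proving identities in x through Binet's formula: X(1-X) is not constant, so
    substituting it is injective, and 2X-1 has constant term -1, hence is nonzero in every
    characteristic. *)
Lemma mul_comp_poly_X1X_inj (R : idomainType) (f g : {poly R}) :
  (2 * 'X - 1) * (f \Po ('X * (1 - 'X))) =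
  (2 * 'X - 1) * (g \Po ('X * (1 - 'X))) -> f = g.
Proof.
have u_neq0 : 2 * 'X - 1 != 0 :> {poly R}.
  apply/eqP => /(congr1 (horner^~ 0)).
  by rewrite !hornerE => /eqP; rewrite oppr_eq0 oner_eq0.
move/(mulfI u_neq0)/eqP; rewrite -subr_eq0 -comp_polyB comp_poly_eq0.
  by rewrite subr_eq0 => /eqP.
have sz : size (1 - 'X : {poly R}) = 2%N by rewrite -size_polyN opprB size_XsubC.
by rewrite mulrC size_mulX ?sz // -size_poly_eq0 sz.
Qed.

Lemma frobenius_sum_diff (R : comNzRingType) (Q : nat) (y : R) :
    [pchar R].-nat Q -> odd Q ->
  (y ^+ Q + (1 - y) ^+ Q = 1) * (y ^+ Q - (1 - y) ^+ Q = (2 * y - 1) ^+ Q).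
Proof.
move=> charQ oddQ; split; first by rewrite -exprDn_pchar // addrC subrK expr1n.
have -> : 2 * y - 1 = y - (1 - y) by ring.
by rewrite [RHS]exprDn_pchar // [(- (1 - y)) ^+ Q]exprNn -signr_odd oddQ expr1 mulN1r.
Qed.

Lemma fibp_pchar_pred (R : idomainType) (N : nat) : [pchar R].-nat N.*2.+1 ->
  fibp N.*2 'X = (1 - 4 * 'X) ^+ N :> {poly R}.
Proof.
rewrite -(eq_pnat _ (@pchar_poly R)) => charQ.
apply: mul_comp_poly_X1X_inj.
rewrite fibp_morph /= comp_polyX fibp_binet frobenius_sum_diff //= ?odd_double //.
rewrite rmorphXn rmorphB rmorph1 rmorphM rmorph_nat /= comp_polyX.
(* With Q = 2N+1, split u^Q as u (u^2)^N. *)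
by rewrite exprS -mul2n exprM; congr (_ * _ ^+ _); ring.
Qed.

Lemma fibp_pchar (R : idomainType) (N : nat) : [pchar R].-nat N.*2.+1 ->
  2 * fibp N.*2.+1 'X = 1 + (1 - 4 * 'X) ^+ N :> {poly R}.
Proof.
rewrite -(eq_pnat _ (@pchar_poly R)) => charQ.
apply: mul_comp_poly_X1X_inj.
rewrite rmorphM rmorph_nat fibp_morph /= comp_polyX mulrCA fibp_binet.
rewrite rmorphD rmorphXn rmorphB rmorph1 rmorphM rmorph_nat /= comp_polyX.
have -> : 1 - 4 * ('X * (1 - 'X)) = (2 * 'X - 1) ^+ 2 :> {poly R} by ring.
have oddQ : odd N.*2.+1 by rewrite /= odd_double.
rewrite [RHS]mulrDr -exprM mul2n -exprS.
rewrite -(frobenius_sum_diff 'X charQ oddQ).2 mulr1.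
have := (frobenius_sum_diff 'X charQ oddQ).1.
rewrite !(exprS _ N.*2.+1); set Y := 'X ^+ _; set Z := (1 - 'X) ^+ _ => sumQ.
(* With Y = y^Q and Z = (1-y)^Q eliminated, both sides become 2(y + Y - 1). *)
have -> : Z = 1 - Y by rewrite -sumQ addrC addKr.
ring.
Qed.

(** The numerator splits as (n+1-i) + (1-k)(i+1), and (i+1) C(n+1-i, i+1) = (n+1-i) C(n-i, i), so
    n+1-i divides both parts. *)
Lemma rdickson_coefS (n k i : nat) : (i <= n)%N ->
  rdickson_coef n.+2 k i.+1 =
  'C(n.+1 - i, i.+1)%:Z + (1 - k%:Z) * 'C(n - i, i)%:Z.
Proof.
move=> le_in; rewrite /rdickson_coef subSS subSn //.
rewrite -[RHS](@mulKz _ (n - i).+1%:Z) //; congr (_ %/ _)%Z.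
have E := mul_bin_diag (n - i).+1 i.
have {}E : (n - i).+1%:Z * 'C(n - i, i)%:Z = i.+1%:Z * 'C((n - i).+1, i.+1)%:Z.
  by rewrite -!PoszM E.
rewrite mulrDr mulrCA E -{1}(subnK le_in).
by rewrite -!addnS PoszD -addn1 !PoszD; ring.
Qed.

Lemma rdickson1SS (R : comNzRingType) (n k : nat) :
  rdickson1 R n.+2 k = fibp n.+2 'X + (k%:R - 1) * 'X * fibp n 'X.
Proof.
rewrite /rdickson1 big_mkord big_ord_recl /fibp big_ord_recl /= !bin0 -addrA.
have -> : (n.+2 %/ 2)%N = (n %/ 2).+1 by lia.
congr (_ + _).
  rewrite /rdickson_coef subn0 bin0 mulr0 subr0 mulr1 divzz /=.
  by rewrite scale1r mul1r.
rewrite mulr_sumr -big_split /=; apply: eq_bigr => i _.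
have le_in : (i <= n)%N by have := ltn_ord i; lia.
rewrite /bump /= add1n rdickson_coefS // !subSS scaler_int.
rewrite -mulrzl rmorphD rmorphM rmorphB /= exprS.
ring.
Qed.

(** Two uses of the recurrence give D = (1+2x) E_Q - x E_(Q-1) for Q = 2N+1. With w = (1-4x)^N,
    doubling yields (1+2x)(1+w) - 2xw, where the products xw cancel. *)
Lemma rdickson1_pchar (R : idomainType) (N : nat) : [pchar R].-nat N.*2.+1 ->
  2 * rdickson1 R N.*2.+3 4 = 1 + 2 * 'X + (1 - 4 * 'X) ^+ N.
Proof.
move=> charQ; rewrite rdickson1SS !fibpSS (fibp_pchar_pred charQ).
have -> : (1 - 4 * 'X) ^+ N = 2 * fibp N.*2.+1 'X - 1 :> {poly R}.
  by rewrite fibp_pchar // [RHS]addrC addKr.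
by ring.
Qed.

Lemma permutation_poly_affine (F : finFieldType) (f g : {poly F}) (a b c d : F) :
    a != 0 -> c != 0 -> (forall x, f.[x] = a * g.[c * x + d] + b) ->
  permutation_poly f <-> permutation_poly g.
Proof.
move=> a0 c0 fE.
have bij_aff (r s : F) : r != 0 -> bijective (fun x => r * x + s).
  move=> r0; exists (fun x => (x - s) / r) => x; first by rewrite addrK mulrC mulKf.
  by rewrite mulrC divfK // subrK.
have [h1 h1K h1K'] := bij_aff a b a0; have [h2 h2K h2K'] := bij_aff c d c0.
split=> [f_bij | g_bij].
  have h_bij := bij_comp (bij_comp (Bijective h1K' h1K) f_bij) (Bijective h2K' h2K).
  by apply: (eq_bij h_bij) => x /=; rewrite fE h1K h2K'.
have aff_bij := bij_comp (bij_comp (bij_aff a b a0) g_bij) (bij_aff c d c0).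
by apply: (eq_bij aff_bij) => x /=; rewrite fE.
Qed.

Theorem theorem2p16 (p q e l : nat) (F : finFieldType)
    (hp : prime p) (hp3 : (3 < p)%N)
    (he : (0 < e)%N) (hq : q = (p ^ e)%N) (hF : #|F| = q) :
  permutation_poly (rdickson1 F (p ^ l + 2) 4) <->
  permutation_poly ('X^((p ^ l - 1) %/ 2) - (2%:R^-1 : F) *: 'X).
Proof.
have charp : p \in [pchar F] by apply: card_finPcharP hp; rewrite hF hq.
have oddp : odd p by case/even_prime: hp hp3 => [->|].
have two_neq0 : 2%:R != 0 :> F by rewrite -(dvdn_pcharf charp) gtnNdvd // ltnW.
(* [N] is the exponent (p^l - 1)/2 of the binomial; it is 0 when l = 0. *)
have [N QE] : exists N, (p ^ l = N.*2.+1)%N.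
  by exists (p ^ l)./2; rewrite -[LHS]odd_double_half oddX oddp orbT.
have charQ : [pchar F].-nat N.*2.+1.
  by rewrite -QE (eq_pnat _ (pcharf_eq charp)) pnatX pnat_id.
rewrite QE addn2 subn1 /= -muln2 mulnK // muln2.
have four_neq0 : 4%:R != 0 :> F by rewrite (natrM _ 2 2) mulf_neq0.
(* Put t = 1-4x. Then 2x = (1-t)/2, so 2D = 1 + 2x + t^N = 3/2 + (t^N - t/2). *)
apply: (@permutation_poly_affine _ _ _ (1 / 2) (3 / 4) (- 4) 1).
- by rewrite div1r invr_eq0.
- by rewrite oppr_eq0.
move=> x; apply: (mulfI two_neq0).
have /(congr1 (horner^~ x)) := rdickson1_pchar charQ.
(* The polynomial numerals become constants [c%:P], which [hornerC] can evaluate. *)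
rewrite -(polyC_natr F 2) -(polyC_natr F 4).
rewrite !(hornerD, hornerN, hornerM, hornerX, hornerXn) !(horner_exp, hornerC).
rewrite !(hornerD, hornerN, hornerM, hornerX, hornerC, hornerZ) => ->.
have -> : 1 - 4 * x = - 4 * x + 1 by ring.
by field; rewrite four_neq0 two_neq0.
Qed.
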